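(* Suppose that $x(t)$ and $u(t)$ solve Problem (PL2), where $u(t)=\dot x(t)-f(x(t),t)$. Then they solve, with an adjoint variable vector $\lambda(t)\in\mathbb{R}^n$ satisfying $u(t)=-\lambda(t)$ for a.e. $t\in[t_0,t_f)$, the two-point boundary-value problem $$\dot{x}(t) = f(x(t),t) - \lambda(t),\qquad x(t_{i-1}) = z_{i-1},\quad x(t_i) = z_i,$$ $$\dot{\lambda}(t) = -f_x(x(t),t)^T\,\lambda(t),$$ for all $t\in[t_{i-1},t_i]$, $i=1,\ldots,N$, with possible jumps in the values of the adjoint variable vector $\lambda(t)$ at $t_i$, $i=1,\ldots,N-1$.
   Context: Let $t_0<t_1<\cdots<t_N=:t_f$ be real numbers and let $z_0,\ldots,z_N\in\mathbb{R}^n$ (the skeleton) be points generated at $t=t_i$, $i=0,\ldots,N$, by an ODE solver for the initial value problem $\dot z(t)=f(z(t),t)$, $z(t_0)=z_0$, with $z_i\neq z_{i-1}$ for $i=1,\ldots,N$. Here $f(x,t)\in\mathbb{R}^n$ is the right-hand side of the ODE, and $f_x(x,t)$ denotes the Jacobian of $f(x,t)$ with respect to $x$. The interval $[t_{i-1},t_i]$ is called the $i$th stage. Problem (PL2): minimize $$\frac12\,\|\dot x(t)-f(x(t),t)\|_{L^2}^2=\frac12\sum_{i=1}^N\int_{t_{i-1}}^{t_i}\|\dot x(t)-f(x(t),t)\|^2\,dt$$ over curves $x:[t_0,t_f]\to\mathbb{R}^n$ subject to $x(t_i)=z_i$, $i=0,\ldots,N$, where $\|\cdot\|$ is the Euclidean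 norm in $\mathbb{R}^n$. Equivalently, with the control variable (residual) $u(t):=\dot x(t)-f(x(t),t)$, minimize $\frac12\sum_{i=1}^N\int_{t_{i-1}}^{t_i}\|u(t)\|^2\,dt$ subject to $\dot x(t)=f(x(t),t)+u(t)$ for a.e. $t\in[t_0,t_f]$ and $x(t_i)=z_i$, $i=0,\ldots,N$. ''$x$ and $u$ solve (PL2)'' means that the pair is optimal. On each stage, $x$ is taken in $W^{1,\infty}$ (functions whose first derivatives lie in $L^\infty$) and $u$ in $L^\infty$; the adjoint variable vector $\lambda$ (the multiplier function from the maximum principle) is in $W^{1,\infty}$ on each stage, and its values on consecutive stages need not match at the common node.
   Formalization: The formal theorem assumes that f is continuous on R^n × [t_0,t_f], differentiable in x, with f_x jointly continuous; without such regularity the equations can fail at some t (e.g. f jumping in t inside a stage). *)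

(* Defs.v *)
From HB Require Import structures.
From mathcomp Require Import all_boot all_order all_algebra.
From mathcomp Require Import all_classical all_reals all_analysis.
Set Implicit Arguments.
Unset Strict Implicit.
Unset Printing Implicit Defensive.
Import Order.TTheory GRing.Theory Num.Theory.
Import numFieldNormedType.Exports.
Local Open Scope classical_set_scope.
Local Open Scope ring_scope.

(* Elements of R^n are row vectors.  The library norm of 'rV[R]_n is the
   maximum norm, so the Euclidean norm is introduced separately. *)
Definition enorm (R : realType) (n : nat) (v : 'rV[R]_n) : R :=
  Num.sqrt (\sum_(j < n) v 0 j ^+ 2).

(* The library's [jacobian] acts on row vectors from the right; its transpose
   is the usual matrix with (i, j) entry d f_i / d x_j. *)
Definition jacobian_x (R : realType) (n : nat) (f : 'rV[R]_n -> R -> 'rV[R]_n)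
    (x : 'rV[R]_n) (s : R) : 'M[R]_n :=
  (jacobian (f^~ s) x)^T.

Definition C1_in_x (R : realType) (n : nat) (f : 'rV[R]_n -> R -> 'rV[R]_n)
    (a b : R) : Prop :=
  let D := [set p : 'rV[R]_n * R | p.2 \in `[a, b]] in
  [/\ {within D, continuous (fun p : 'rV[R]_n * R => f p.1 p.2)},
      (forall s : R, s \in `[a, b] ->
         forall x : 'rV[R]_n, differentiable (f^~ s) x)
    & {within D, continuous
        (fun p : 'rV[R]_n * R => jacobian_x f p.1 p.2)}].

Definition Linfty (R : realType) (n : nat) (a b : R) (u : R -> 'rV[R]_n) : Prop :=
  forall j : 'I_n,
    (fun s => u s 0 j) \_ `[a, b] \in Lfun (@lebesgue_measure R) +oo%E.

(* W^{1,oo}([a, b]; R^n), with functions identified with their continuous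
   representatives: x has the weak derivative v in L^oo. *)
Definition W1infty (R : realType) (n : nat) (a b : R) (x : R -> 'rV[R]_n) : Prop :=
  exists v : R -> 'rV[R]_n, Linfty a b v /\
    forall s : R, s \in `[a, b] -> forall j : 'I_n,
      x s 0 j = x a 0 j + \int[lebesgue_measure]_(r in `[a, s]) v r 0 j.

(* y is the derivative at s of the restriction of x to A; at an endpoint of an
   interval A this is the one-sided derivative. *)
Definition has_derivative_on (R : realType) (n : nat) (A : set R)
    (x : R -> 'rV[R]_n) (s : R) (y : 'rV[R]_n) : Prop :=
  (r - s)^-1 *: (x r - x s) @[r --> within (A `\ s) (nbhs s)] --> y.

(* Stages are indexed from 0: stage i is [t i, t i.+1], for i < N.  Only the
   values t 0, ..., t N and z 0, ..., z N are relevant. *)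
Definition PL2_feasible (R : realType) (n N : nat)
    (f : 'rV[R]_n -> R -> 'rV[R]_n) (t : nat -> R) (z : nat -> 'rV[R]_n)
    (x u : R -> 'rV[R]_n) : Prop :=
  [/\ (forall i : nat, (i < N)%N ->
         W1infty (t i) (t i.+1) x /\ Linfty (t i) (t i.+1) u),
      (\forall s \ae (@lebesgue_measure R), s \in `[t 0%N, t N] ->
         is_derive s 1 x (f (x s) s + u s))
    & (forall i : nat, (i <= N)%N -> x (t i) = z i)].

Definition PL2_cost (R : realType) (n N : nat) (t : nat -> R)
    (u : R -> 'rV[R]_n) : \bar R :=
  (2^-1%:E * \sum_(i < N)
     \int[lebesgue_measure]_(s in `[t i, t i.+1]) (enorm (u s) ^+ 2)%:E)%E.

Definition PL2_solution (R : realType) (n N : nat)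
    (f : 'rV[R]_n -> R -> 'rV[R]_n) (t : nat -> R) (z : nat -> 'rV[R]_n)
    (x u : R -> 'rV[R]_n) : Prop :=
  PL2_feasible N f t z x u /\
  forall y v : R -> 'rV[R]_n, PL2_feasible N f t z y v ->
    (PL2_cost N t u <= PL2_cost N t v)%E.

Definition stage_bvp (R : realType) (n : nat)
    (f : 'rV[R]_n -> R -> 'rV[R]_n) (a b : R) (za zb : 'rV[R]_n)
    (x q : R -> 'rV[R]_n) : Prop :=
  [/\ x a = za, x b = zb &
      forall s : R, s \in `[a, b] ->
        has_derivative_on `[a, b] x s (f (x s) s - q s) /\
        has_derivative_on `[a, b] q s
          (- ((jacobian_x f (x s) s)^T *m (q s)^T)^T)].

(* Main.v *)
(* Each stage is a fixed-endpoint problem with a full control, so the classical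
   direct method applies and no abnormal case arises.  Perturb x in direction j
   by e * phi, where phi is the primitive of a bounded h supported in the stage
   with integral 0: the result is feasible, with control
   u + f(x) - f(x + e phi) + e h.  Dividing the change of cost by e and letting
   e tend to 0 (dominated convergence) gives the weak Euler-Lagrange equation
   \int u_j h = \int (f_x^T u)_j phi, and the du Bois-Reymond lemma (integrate
   by parts and take for h the centered function u_j + \int (f_x^T u)_j) makes
   u equal a.e. to an absolutely continuous -lambda.  Both x and lambda are then
   primitives of continuous functions, so the equations hold at every time. *)

Require Import Defs.
From HB Require Import structures.
From mathcomp Require Import all_boot all_order all_algebra.
From mathcomp Require Import all_classical all_reals all_analysis.
From mathcomp Require Import measurable_realfun ess_sup_inf ring lra.
Set Implicit Arguments.
Unset Strict Implicit.
Unset Printing Implicit Defensive.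
Import Order.TTheory GRing.Theory Num.Theory.
Import numFieldNormedType.Exports.
Local Open Scope classical_set_scope.
Local Open Scope ring_scope.

(* The library's own hint does not see through the display of the Lebesgue
   measure. *)
#[local] Hint Extern 0 (Filter (nbhs (almost_everywhere _))) =>
  (exact: (ae_filter_ringOfSetsType (@lebesgue_measure _)))
  : typeclass_instances.

(** * Essentially bounded functions on subsets of the line *)

Section EssentiallyBounded.
Context {R : realType}.
Notation mu := (@lebesgue_measure R).
Implicit Types (D : set R) (g h : R -> R).

(** Membership in L^oo with an explicit a.e. bound, a form that passes easily through sums, products
    and restrictions; [ess_bounded_Lfun] links it with [Lfun]. *)
Definition ess_bounded D g :=
  measurable_fun D g /\ exists M, \forall s \ae mu, D s -> `|g s| <= M.

Lemma ess_boundedD D g h : ess_bounded D g -> ess_bounded D h ->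
  ess_bounded D (fun s => g s + h s).
Proof.
move=> [mg [M gM]] [mh [K hK]]; split; first exact: measurable_funD.
exists (M + K); apply: filterS2 gM hK => s gM hK Ds.
by rewrite (le_trans (ler_normD _ _))// lerD ?gM ?hK.
Qed.

Lemma ess_boundedM D g h : ess_bounded D g -> ess_bounded D h ->
  ess_bounded D (fun s => g s * h s).
Proof.
move=> [mg [M gM]] [mh [K hK]]; split; first exact: measurable_funM.
exists (M * K); apply: filterS2 gM hK => s gM hK Ds.
by rewrite normrM ler_pM ?gM ?hK.
Qed.

Lemma ess_bounded_cst D c : ess_bounded D (fun=> c).
Proof. by split => //; exists `|c|; apply: aeW. Qed.

Lemma ess_boundedN D g : ess_bounded D g -> ess_bounded D (fun s => - g s).
Proof.
move=> [mg [M gM]]; split; first exact: measurableT_comp.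
by exists M; apply: filterS gM => s; rewrite normrN.
Qed.

Lemma ess_bounded_sum (I : Type) (r : seq I) D (G : I -> R -> R) :
  (forall i, ess_bounded D (G i)) ->
  ess_bounded D (fun s => \sum_(i <- r) G i s).
Proof.
move=> bG; elim: r => [|i r IH].
  by under eq_fun do rewrite big_nil; exact: ess_bounded_cst.
by under eq_fun do rewrite big_cons; exact: ess_boundedD.
Qed.

Lemma ess_boundedS D E g : measurable E -> D `<=` E ->
  ess_bounded E g -> ess_bounded D g.
Proof.
move=> mE DE [mg [M gM]]; split; first exact: measurable_funS mg.
by exists M; apply: filterS gM => s gM /DE.
Qed.

Lemma ess_bounded_integrable D g : measurable D -> (mu D < +oo)%E ->
  ess_bounded D g -> mu.-integrable D (EFin \o g).
Proof.
move=> mD Doo [mg [M gM]]; apply/integrableP; split; first exact/measurable_EFinP.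
apply: le_lt_trans.
  apply: (integral_le_bound (`|M|)%:E) => //.
  - exact: measurableT_comp.
  - apply: filterS gM => s gM /gM /le_trans; rewrite lee_fin; apply.
    exact: ler_norm.
by rewrite lte_mul_pinfty.
Qed.

Lemma ess_bounded_restrict D g : measurable D ->
  ess_bounded D g <-> ess_bounded setT (g \_ D).
Proof.
move=> mD; rewrite /ess_bounded -(measurable_restrictT _ mD); split.
  (* The bound must also cover the value 0 taken outside [D]: [M] alone may be negative when [D] is
     negligible. *)
  move=> [mg [M gM]]; split => //; exists (Num.max M 0).
  apply: filterS gM => s gM _; rewrite patchE; case: ifPn => [/set_mem/gM|_].
    by rewrite le_max => ->.
  by rewrite normr0 le_max lexx orbT.
move=> [mg [M gM]]; split => //; exists M.
by apply: filterS gM => s /(_ I) + Ds; rewrite patchE mem_set.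
Qed.

Lemma ess_bounded_Lfun g :
  ess_bounded setT g <-> g \in Lfun mu +oo%E.
Proof.
(* The L^oo norm unfolds to an essential supremum once the whole space is known to have positive
   measure. *)
have muT : (0 < mu setT)%E.
  by rewrite -set_itvNyy lebesgue_measure_itv /=; exact: (ltry 0).
split=> [[mg [M gM]]|/andP[/set_mem mg /set_mem]].
  apply/andP; split; first exact/mem_set.
  apply/mem_set; rewrite /= /finite_norm unlock muT.
  apply: (@le_lt_trans _ _ M%:E); last exact: ltry.
  by apply/ess_supP; apply: filterS gM => s /= /(_ I).
rewrite /= /finite_norm unlock muT => gy.
split=> //.
have [M HM] := @ess_supr_bounded _ _ _ mu (fun s => `|g s|) gy.
by exists M; apply: filterS HM.
Qed.

Lemma ess_bounded_continuous (a b : R) g :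
  {within `[a, b], continuous g} -> ess_bounded `[a, b] g.
Proof.
move=> cg; split.
  by apply: subspace_continuous_measurable_fun.
have /compact_bounded[M [_ HM]] :=
  continuous_compact cg (@segment_compact _ a b).
exists (`|M| + 1); apply: aeW => s Ds; apply: HM; last by exists s.
by rewrite ltr_pwDr// ler_norm.
Qed.

End EssentiallyBounded.

(** * Integration by parts for primitives of integrable functions *)

Section IntegrationByParts.
Context {R : realType}.
Notation mu := (@lebesgue_measure R).
Implicit Types p h : R -> R.

(** By Tonelli, the iterated integral of the absolute value is the product of the two L^1 norms,
    hence finite. *)
Lemma integrable_prodmul p h :
  mu.-integrable setT (EFin \o p) -> mu.-integrable setT (EFin \o h) ->
  (mu \x mu)%E.-integrable setT (fun z : R * R => (p z.1 * h z.2)%:E).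
Proof.
move=> ip ih.
have mp : measurable_fun setT p by apply/measurable_EFinP; case/integrableP: ip.
have mh : measurable_fun setT h by apply/measurable_EFinP; case/integrableP: ih.
have mph : measurable_fun setT (fun z : R * R => (p z.1 * h z.2)%:E).
  apply/measurable_EFinP; apply: measurable_funM.
    by apply: measurableT_comp => //; exact: measurable_fst.
  by apply: measurableT_comp => //; exact: measurable_snd.
have := @integrable12ltyP _ _ _ _ _ mu mu _ mph; move=> [_]; apply => /=.
have hfin : (\int[mu]_r `|(h r)%:E|)%E \is a fin_num.
  rewrite ge0_fin_numE ?integral_ge0//.
  by case/integrableP: ih.
have E s : (\int[mu]_r `|(p s * h r)%:E|
    = (fine (\int[mu]_r `|(h r)%:E|))%:E * `|(p s)%:E|)%E.
  under eq_integral do rewrite EFinM abseM.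
  rewrite ge0_integralZl//=; last first.
    by apply: measurableT_comp => //; apply: measurableT_comp.
  by rewrite muleC fineK.
under eq_integral do rewrite E.
rewrite ge0_integralZl//=.
- rewrite lte_mul_pinfty//; last by case/integrableP: ip.
  by rewrite lee_fin fine_ge0// integral_ge0.
- by apply: measurableT_comp => //; apply: measurableT_comp.
- by rewrite lee_fin fine_ge0// integral_ge0.
Qed.

Lemma Rintegral_restrictM p (c : R) (D : set R) : measurable D ->
  mu.-integrable setT (EFin \o p) ->
  (\int[mu]_r (c * (p \_ D) r)%:E = (c * \int[mu]_(r in D) p r)%:E)%E.
Proof.
move=> mD ip.
have iD : mu.-integrable D (EFin \o p) by apply: integrableS ip.
have iT : mu.-integrable setT (EFin \o (p \_ D)).
  by move/integrable_mkcond: iD => /(_ mD); rewrite restrict_EFin.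
rewrite -(fineK (@integrable_fin_num _ _ _ mu setT _ _ (integrableZl _ c iT)))//.
congr EFin; rewrite Rintegral_mkcond -RintegralZl//.
Qed.

Lemma Rintegral_geE p r : mu.-integrable setT (EFin \o p) ->
  \int[mu]_(s in `[r, +oo[) p s
  = \int[mu]_s p s - \int[mu]_(s in `]-oo, r]) p s.
Proof.
move=> ip.
have iS D : measurable D -> mu.-integrable D (EFin \o p).
  by move=> mD; apply: integrableS ip.
rewrite -Rintegral_itv_obnd_cbnd; last exact: iS.
rewrite -(@Rintegral_itvB _ p -oo%O +oo%O r)//; last exact: iS.
by rewrite set_itvNyy.
Qed.

(** The product p(s) h(r) cut off to the half-plane r <= s, where z = (s, r). Integrating in r first
    produces the primitive of [h], integrating in s first the tail integral of [p]. *)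
Let triangle p h (z : R * R) : \bar R := (p z.1 * h z.2 * (z.2 <= z.1)%R%:R)%:E.

Let integrable_triangle p h :
  mu.-integrable setT (EFin \o p) -> mu.-integrable setT (EFin \o h) ->
  (mu \x mu)%E.-integrable setT (triangle p h).
Proof.
move=> ip ih.
have mp : measurable_fun setT p by apply/measurable_EFinP; case/integrableP: ip.
have mh : measurable_fun setT h by apply/measurable_EFinP; case/integrableP: ih.
apply: le_integrable (integrable_prodmul ip ih) => //.
  apply/measurable_EFinP; apply: measurable_funM; first apply: measurable_funM.
  - by apply: measurableT_comp => //; exact: measurable_fst.
  - by apply: measurableT_comp => //; exact: measurable_snd.
  - apply: (@measurableT_comp _ _ _ _ _ _ (fun b : bool => b%:R : R)) => //.
    apply: measurable_fun_ler; [exact: measurable_snd|exact: measurable_fst].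
move=> z _; rewrite /triangle /= lee_fin normrM; case: (z.2 <= z.1)%R.
  by rewrite normr1 mulr1.
by rewrite normr0 mulr0.
Qed.

Let triangle_sectionl p h s : mu.-integrable setT (EFin \o h) ->
  (\int[mu]_r triangle p h (s, r) = (p s * \int[mu]_(r in `]-oo, s]) h r)%:E)%E.
Proof.
move=> ih; rewrite -Rintegral_restrictM//; apply: eq_integral => r _.
rewrite /triangle /= patchE mem_setE in_itv /=; case: (r <= s)%R.
  by rewrite mulr1.
by rewrite !mulr0.
Qed.

Let triangle_sectionr p h r : mu.-integrable setT (EFin \o p) ->
  (\int[mu]_s triangle p h (s, r) = (h r * \int[mu]_(s in `[r, +oo[) p s)%:E)%E.
Proof.
move=> ip; rewrite -Rintegral_restrictM//; apply: eq_integral => s _.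
rewrite /triangle /= patchE mem_setE in_itv /= andbT; case: (r <= s)%R.
  by rewrite mulr1 mulrC.
by rewrite !mulr0.
Qed.

Lemma integrable_mul_primitive p h :
  mu.-integrable setT (EFin \o p) -> mu.-integrable setT (EFin \o h) ->
  mu.-integrable setT (fun s => (p s * \int[mu]_(r in `]-oo, s]) h r)%:E).
Proof.
move=> ip ih; have := integrable_fubini_F (integrable_triangle ip ih).
by apply: eq_integrable => // s _; rewrite -triangle_sectionl.
Qed.

(** Fubini for [triangle] asks only for integrability of [p] and [h]. It trades the primitive of [h]
    for the integral of [p] over [r, +oo[, which is the total integral of [p] minus its primitive at
    r. *)
Lemma Rintegration_by_parts_primitive p h :
  mu.-integrable setT (EFin \o p) -> mu.-integrable setT (EFin \o h) ->
  \int[mu]_s (p s * \int[mu]_(r in `]-oo, s]) h r) =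
  (\int[mu]_s p s) * (\int[mu]_s h s)
    - \int[mu]_s (h s * \int[mu]_(r in `]-oo, s]) p r).
Proof.
move=> ip ih; have := Fubini (integrable_triangle ip ih).
under eq_integral do rewrite triangle_sectionl//.
under [X in _ = X -> _]eq_integral do rewrite triangle_sectionr//.
move=> /(congr1 fine) E; rewrite [LHS]E mulrC -RintegralZr// -RintegralB//.
- by apply: eq_Rintegral => r _; rewrite Rintegral_geE// mulrBr.
- rewrite -[X in integrable _ _ X]
    /(fun x => ((h x)%:E * (\int[mu]_s p s)%:E)%E).
  exact: integrableZr.
- exact: integrable_mul_primitive.
Qed.
End IntegrationByParts.

(** * The du Bois-Reymond lemma *)

Section DuBoisReymond.
Context {R : realType}.
Notation mu := (@lebesgue_measure R).
Implicit Types (a b s : R) (p q h : R -> R).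

Lemma ess_bounded_integrable_itv a b g : ess_bounded `[a, b] g ->
  mu.-integrable `[a, b] (EFin \o g).
Proof.
apply: ess_bounded_integrable => //.
by rewrite /= lebesgue_measure_itv /=; case: ifP => _; rewrite ?EFinN -?EFinB ltry.
Qed.

Lemma ess_bounded_integrableT a b g : ess_bounded `[a, b] g ->
  mu.-integrable setT (EFin \o (g \_ `[a, b])).
Proof.
move=> /ess_bounded_integrable_itv /integrable_mkcond.
by rewrite restrict_EFin; apply.
Qed.

Lemma Rintegral_restrict_primitive a b g s : s \in `[a, b] ->
  \int[mu]_(r in `]-oo, s]) (g \_ `[a, b]) r = \int[mu]_(r in `[a, s]) g r.
Proof.
rewrite in_itv /= => /andP[sa sb]; rewrite -Rintegral_mkcondr; congr (Rintegral _ _ _).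
apply/seteqP; split => r /=; rewrite !in_itv /=; first by move=> [-> /andP[->]].
by move=> /andP[-> rs]; rewrite rs (le_trans rs).
Qed.

Lemma ess_bounded_primitive a b g : a <= b -> ess_bounded `[a, b] g ->
  {within `[a, b], continuous (fun s => \int[mu]_(r in `[a, s]) g r)}.
Proof.
move=> ab /ess_bounded_integrable_itv.
exact: parameterized_integral_continuous.
Qed.

Lemma ess_bounded_ae_eq (D : set R) g h : measurable D -> ess_bounded D g ->
  ess_bounded D h -> (\forall s \ae mu, D s -> g s = h s) ->
  \int[mu]_(s in D) g s = \int[mu]_(s in D) h s.
Proof.
move=> mD [mg _] [mh _] gh; congr fine; apply: ae_eq_integral => //.
- exact/measurable_EFinP.
- exact/measurable_EFinP.
- by apply: filterS gh => s gh Ds; rewrite gh.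
Qed.

(** With Q the primitive of [q], integration by parts turns the hypothesis into \int (p + Q) h = 0
    for all admissible h. Testing with h = p + Q - c, where c is the mean of p + Q, gives \int (p +
    Q - c)^2 = 0. *)
Lemma du_bois_reymond a b p q : a < b ->
  ess_bounded `[a, b] p -> ess_bounded `[a, b] q ->
  (forall h, ess_bounded setT h -> (forall s, s \notin `[a, b] -> h s = 0) ->
    \int[mu]_s h s = 0 ->
    \int[mu]_(s in `[a, b]) (p s * h s) =
    \int[mu]_(s in `[a, b]) (q s * \int[mu]_(r in `]-oo, s]) h r)) ->
  exists c, \forall s \ae mu, s \in `[a, b] ->
    p s = c - \int[mu]_(r in `[a, s]) q r.
Proof.
move=> ab bp bq weak.
have mI : measurable (`[a, b]%classic : set R) by [].
pose Q s := \int[mu]_(r in `[a, s]) q r.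
have bQ : ess_bounded `[a, b] Q.
  by apply: ess_bounded_continuous; apply: ess_bounded_primitive => //; exact: ltW.
(* The mean value of [p + Q] is the constant that gives [w] integral 0, so that [w] extended by 0 is
   an admissible test function. *)
pose c := (\int[mu]_(s in `[a, b]) (p s + Q s)) / (b - a).
pose w s := p s + Q s - c.
have bpQ : ess_bounded `[a, b] (fun s => p s + Q s) by exact: ess_boundedD.
have bc : ess_bounded `[a, b] (fun=> c) by exact: ess_bounded_cst.
have bw : ess_bounded `[a, b] w.
  by apply: ess_boundedD => //; exact: ess_bounded_cst.
have w0 : \int[mu]_(s in `[a, b]) w s = 0.
  rewrite RintegralB//; last 2 first.
  - exact: ess_bounded_integrable_itv.
  - exact: ess_bounded_integrable_itv.
  rewrite Rintegral_cst//= lebesgue_measure_itv /= lte_fin ab /=.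
  by rewrite /c mulfVK ?subrr// subr_eq0 gt_eqF.
pose h := w \_ `[a, b].
have hE s : s \in `[a, b] -> h s = w s.
  by move=> sab; rewrite /h patchE mem_set.
have weak_h : \int[mu]_(s in `[a, b]) (p s * w s) =
    - \int[mu]_(s in `[a, b]) (w s * Q s).
  transitivity (\int[mu]_(s in `[a, b]) (p s * h s)).
    by apply: eq_Rintegral => s /set_mem sab; rewrite hE.
  rewrite weak.
  - transitivity (\int[mu]_s ((q \_ `[a, b]) s * \int[mu]_(r in `]-oo, s]) h r)).
      rewrite Rintegral_mkcond; apply: eq_Rintegral => s _.
      by rewrite !patchE; case: ifP => // _; rewrite mul0r.
    rewrite Rintegration_by_parts_primitive; last 2 first.
    - exact: ess_bounded_integrableT.
    - exact: ess_bounded_integrableT.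
    (* The boundary term contains the factor \int h = 0. *)
    rewrite -[X in _ * X - _]Rintegral_mkcond w0 mulr0 sub0r; congr (- _).
    rewrite [RHS]Rintegral_mkcond; apply: eq_Rintegral => s _.
    rewrite /h !patchE; case: ifPn => [/set_mem sab|_]; last by rewrite mul0r.
    by rewrite Rintegral_restrict_primitive.
  - exact/(ess_bounded_restrict _ mI).
  - by move=> s sab; rewrite /h patchE memNset//; exact/negP.
  - by rewrite -Rintegral_mkcond.
(* Expanding one factor, w^2 = p w + Q w - c w: the first two integrals cancel by [weak_h], the
   third is 0 by [w0]. *)
have ww0 : \int[mu]_(s in `[a, b]) (w s * w s) = 0.
  under eq_Rintegral do rewrite {1}/w mulrBl mulrDl.
  have bM g k : ess_bounded `[a, b] g -> ess_bounded `[a, b] k ->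
      mu.-integrable `[a, b] (fun s => (g s * k s)%:E).
    by move=> bg bk; apply: ess_bounded_integrable_itv; exact: ess_boundedM.
  rewrite RintegralB//; last 2 first.
  - apply: ess_bounded_integrable_itv.
    by apply: ess_boundedD; exact: ess_boundedM.
  - exact: bM.
  rewrite RintegralD//; [|exact: bM|exact: bM].
  rewrite RintegralZl//; last exact: ess_bounded_integrable_itv.
  rewrite w0 mulr0 subr0 weak_h addrC.
  by under eq_Rintegral do rewrite mulrC; rewrite subrr.
have bww : ess_bounded `[a, b] (fun s => w s * w s) by exact: ess_boundedM.
have : (\int[mu]_(s in `[a, b]) `|(w s * w s)%:E| = 0)%E.
  under eq_integral do rewrite gee0_abs ?lee_fin -?expr2 ?sqr_ge0//.
  rewrite -[LHS]fineK; last first.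
    by apply: integrable_fin_num => //; exact: ess_bounded_integrable_itv.
  by congr EFin; rewrite -[RHS]ww0; apply: eq_Rintegral => s _; rewrite expr2.
move=> /ae_eq_integral_abs ae0; exists c.
have /ae0 : measurable_fun `[a, b] (fun s => (w s * w s)%:E).
  by apply/measurable_EFinP; case: bww.
move=> /(_ mI); apply: filterS => s + sab => /(_ sab) [] /eqP.
by rewrite mulf_eq0 orbb /w -/(Q s) => /eqP; lra.
Qed.

End DuBoisReymond.

(** * First variation of the quadratic cost *)

Section FirstVariation.
Context {R : realType}.
Notation mu := (@lebesgue_measure R).

Lemma ess_bounded_norm (D : set R) (g : R -> R) :
  ess_bounded D g -> ess_bounded D (fun s => `|g s|).
Proof.
move=> [mg [M gM]]; split; first exact: measurableT_comp.
by exists M; apply: filterS gM => s; rewrite normr_id.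
Qed.

Lemma ess_bounded_sqr (D : set R) (g : R -> R) :
  ess_bounded D g -> ess_bounded D (fun s => g s ^+ 2).
Proof. exact: (fun bg => ess_boundedM bg bg). Qed.

Lemma ess_bounded_le (D : set R) (g h : R -> R) : measurable_fun D g ->
  ess_bounded D h -> (forall s, D s -> `|g s| <= h s) -> ess_bounded D g.
Proof.
move=> mg [mh [M hM]] gh; split=> //; exists M; apply: filterS hM => s hM Ds.
by rewrite (le_trans (gh _ Ds))// (le_trans (ler_norm _))// hM.
Qed.

(** Here [p] stands for the control and [p + e d_ m] for its competitor at step e = 1 / (m + 1). The
    cost change divided by 2 e is nonnegative, and [B] allows its limit to be taken by dominated
    convergence. *)
Lemma first_variation_ge0 (a b : R) (n : nat) (p d : 'I_n -> R -> R)
    (d_ : nat -> 'I_n -> R -> R) (B : R -> R) :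
  (forall k, ess_bounded `[a, b] (p k)) ->
  (forall m k, measurable_fun `[a, b] (d_ m k)) ->
  ess_bounded `[a, b] B ->
  (forall m k s, s \in `[a, b] -> `|d_ m k s| <= B s) ->
  (forall k s, s \in `[a, b] -> d_ m k s @[m --> \oo] --> d k s) ->
  (forall m, \int[mu]_(s in `[a, b]) (\sum_k p k s ^+ 2) <=
    \int[mu]_(s in `[a, b]) (\sum_k (p k s + m.+1%:R^-1 * d_ m k s) ^+ 2)) ->
  0 <= \int[mu]_(s in `[a, b]) (\sum_k p k s * d k s).
Proof.
move=> bp md bB dB dd opt.
have mI : measurable (`[a, b]%classic : set R) by [].
have bd m k : ess_bounded `[a, b] (d_ m k).
  by apply: (ess_bounded_le (md m k) bB) => s; exact: dB.
(* The change of the sum of squares divided by 2 e; its second term disappears in the limit. *)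
pose G m s := \sum_k (p k s * d_ m k s + m.+1%:R^-1 * (2^-1 * (d_ m k s * d_ m k s))).
pose G0 s := \sum_k p k s * d k s.
(* Dominates every [G m], since e and 1/2 are at most 1. *)
pose g s := \sum_k (`|p k s| * B s + B s * B s).
have bc c : ess_bounded `[a, b] (fun=> c) by exact: ess_bounded_cst.
have bG m : ess_bounded `[a, b] (G m).
  apply: ess_bounded_sum => k; apply: ess_boundedD; first exact: ess_boundedM.
  by do 2 apply: ess_boundedM => //; exact: ess_boundedM.
have bg : ess_bounded `[a, b] g.
  apply: ess_bounded_sum => k; apply: ess_boundedD; last exact: ess_boundedM.
  by apply: ess_boundedM => //; exact: ess_bounded_norm.
have GG0 s : s \in `[a, b] -> G m s @[m --> \oo] --> G0 s.
  move=> sab; apply: cvg_big => [|k _]; first exact: add_continuous.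
  rewrite -[X in _ --> X]addr0; apply: cvgD.
    by apply: cvgMr; exact: dd.
  rewrite -[X in _ --> X](mul0r (2^-1 * (d k s * d k s))).
  apply: cvgM; first exact: cvg_harmonic.
  by apply: cvgMr; apply: cvgM; exact: dd.
have bpp : ess_bounded `[a, b] (fun s => \sum_k p k s ^+ 2).
  by apply: ess_bounded_sum => k; exact: ess_bounded_sqr.
have Gge0 m : 0 <= \int[mu]_(s in `[a, b]) G m s.
  (* Multiplication by 2 e recovers the difference of the two costs compared in [opt]. *)
  have e0 : 0 < 2 * m.+1%:R^-1 :> R by rewrite mulr_gt0// invr_gt0.
  have bpd : ess_bounded `[a, b]
      (fun s => \sum_k (p k s + m.+1%:R^-1 * d_ m k s) ^+ 2).
    apply: ess_bounded_sum => k; apply: ess_bounded_sqr.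
    by apply: ess_boundedD => //; exact: ess_boundedM.
  rewrite -(pmulr_rge0 _ e0) -RintegralZl//; last exact: ess_bounded_integrable_itv.
  have := opt m; rewrite -subr_ge0 -RintegralB//.
  - congr (0 <= _); apply: eq_Rintegral => s _.
    rewrite /G mulr_sumr -sumrB; apply: eq_bigr => k _.
    by set e := m.+1%:R^-1; field.
  - exact: ess_bounded_integrable_itv bpd.
  - exact: ess_bounded_integrable_itv bpp.
have mG0 : measurable_fun `[a, b] G0.
  apply: (@measurable_fun_cvg _ _ _ _ G) => //.
    by move=> m; case: (bG m).
have [|||||iG0 _ cG] := @dominated_convergence _ _ _ mu `[a, b]%classic mI
  (fun m s => (G m s)%:E) (EFin \o G0) (EFin \o g).
- by move=> m; apply/measurable_EFinP; case: (bG m).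
- exact/measurable_EFinP.
- by apply: aeW => s sab; apply: cvg_EFin; [exact: nearW|exact: GG0].
- exact: ess_bounded_integrable_itv.
- apply: aeW => s m sab; rewrite lee_fin /G /g (le_trans (ler_norm_sum _ _ _))//.
  apply: ler_sum => k _; rewrite (le_trans (ler_normD _ _))// !normrM.
  have B0 : 0 <= B s by rewrite (le_trans _ (dB m k s sab)).
  have dle := dB m k s sab.
  rewrite lerD// ?ler_wpM2l// -[leRHS]mul1r ler_pM ?mulr_ge0//.
    by rewrite ger0_norm ?invr_ge0// invf_le1// ler1n.
  rewrite -[leRHS]mul1r ler_pM ?mulr_ge0// ?ler_pM//.
  by rewrite ger0_norm// invf_le1// ler1n.
apply: fine_ge0; rewrite -(cvg_lim _ cG)//.
apply: lime_ge; first by apply/cvg_ex; eexists; exact: cG.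
apply: nearW => m /=.
rewrite -[X in (_ <= X)%E]fineK ?lee_fin ?Gge0//.
by apply: integrable_fin_num => //; exact: ess_bounded_integrable_itv.
Qed.

End FirstVariation.

(** * Continuity relative to a subset *)

Section WithinContinuity.

Lemma within_continuous_comp_within (T U V : topologicalType) (A : set T) (B : set U)
    (g : T -> U) (h : U -> V) :
  {within A, continuous g} -> (forall x, A x -> B (g x)) ->
  {within B, continuous h} -> {within A, continuous (h \o g)}.
Proof.
move=> /subspace_continuousP cg gAB /subspace_continuousP ch.
apply/subspace_continuousP => x Ax.
move=> P /(ch _ (gAB _ Ax)) /(cg _ Ax) /=.
by rewrite /nbhs/= /within/=; apply: filterS => y yP Ay; apply: yP => //; exact: gAB.
Qed.
Arguments within_continuous_comp_within {T U V A B g h} cg gAB ch : rename.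

Lemma cvg_mx (R : realFieldType) (T : Type) (F : set_system T) (m n : nat)
    (M : T -> 'M[R]_(m, n)) (L : 'M[R]_(m, n)) : Filter F ->
  (forall i j, M x i j @[x --> F] --> L i j) -> M x @[x --> F] --> L.
Proof.
move=> FF ML; apply/cvgrPdist_le => /= e e0; near=> x.
rewrite /Num.Def.normr/= mx_normrE (bigmax_le _ (ltW e0))//= => i _.
rewrite !mxE/=; move: i; near: x; apply: filter_forall => /= i.
exact: ((cvgrPdist_le _ _).1 (ML i.1 i.2)).
Unshelve. all: by end_near. Qed.

Context {R : realType}.

Lemma within_continuous_rV (T : topologicalType) (A : set T) (n : nat)
    (x : T -> 'rV[R]_n) :
  (forall j, {within A, continuous (fun s => x s 0 j)}) ->
  {within A, continuous x}.
Proof.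
move=> cx s; apply: cvg_mx => i j; rewrite ord1; exact: cx.
Qed.

Lemma within_continuous_pair (T U V : topologicalType) (A : set T)
    (g : T -> U) (h : T -> V) :
  {within A, continuous g} -> {within A, continuous h} ->
  {within A, continuous (fun s => (g s, h s))}.
Proof. by move=> cg ch s; apply: cvg_pair; [exact: cg|exact: ch]. Qed.

Lemma within_continuous_id (T : topologicalType) (A : set T) :
  {within A, continuous (@id T)}.
Proof. by apply: continuous_subspaceT => s; exact: cvg_id. Qed.

End WithinContinuity.

(** * Derivatives along a line *)

Section LineDerivative.
Context {R : realType} {n : nat}.

(** The difference quotients in [r] at [tau] are those of [F] at [p + tau *: v] in direction [v]. *)
Lemma is_derive_line (F : 'rV[R]_n -> 'rV[R]_n) (p v : 'rV[R]_n) (tau : R) k :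
  (forall y, differentiable F y) ->
  is_derive tau 1 (fun r => F (p + r *: v) 0 k)
    ((v *m jacobian F (p + tau *: v)) 0 k).
Proof.
move=> dF.
have D : is_derive tau 1 (fun r => F (p + r *: v)) (v *m jacobian F (p + tau *: v)).
  rewrite -deriveEjacobian//.
  have E : (fun h => h^-1 *: (F (p + (h *: 1 + tau) *: v) - F (p + tau *: v)))
         = (fun h => h^-1 *: (F (h *: v + (p + tau *: v)) - F (p + tau *: v))).
    apply/funext => h; congr (_ *: (F _ - _)).
    by rewrite [h *: 1]mulr1 scalerDl addrCA.
  have dd : derivable F (p + tau *: v) v by exact: diff_derivable.
  by split; [rewrite /derivable E|rewrite /derive E].
pose G (r : R) := F (p + r *: v).
have dG : derivable G tau 1 by case: D.
have dk : derivable (fun r => G r 0 k) tau 1 by move/derivable_mxP: dG; apply.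
split=> //; have := derive_mx dG.
by rewrite (@derive_val _ _ _ _ _ _ _ D) => ->; rewrite mxE.
Qed.

End LineDerivative.

(** * Variations of state and control on a stage *)

Section StageVariation.
Context {R : realType} {n : nat}.
Notation mu := (@lebesgue_measure R).
Implicit Types (f : 'rV[R]_n -> R -> 'rV[R]_n) (x u : R -> 'rV[R]_n).

Lemma within_continuous_eq (T U : topologicalType) (A : set T) (g h : T -> U) :
  (forall s, A s -> g s = h s) -> {within A, continuous g} ->
  {within A, continuous h}.
Proof.
move=> gh; apply: subspace_eq_continuous => s /set_mem; exact: gh.
Qed.

Lemma within_continuous_coord (T : topologicalType) (A : set T) (m p : nat)
    (M : T -> 'M[R]_(m, p)) i j :
  {within A, continuous M} -> {within A, continuous (fun s => M s i j)}.
Proof.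
move=> cM s; apply: (@cvg_comp _ _ _ M (fun N : 'M[R]_(m, p) => N i j) _ _ _ (cM s)).
exact: coord_continuous.
Qed.

Lemma restrict_id (a b : R) (h : R -> R) : (forall s, s \notin `[a, b] -> h s = 0) ->
  h \_ `[a, b] = h.
Proof.
move=> h0; apply/funext => s; rewrite patchE; case: ifPn => // sab.
by rewrite h0//; apply: contra sab => sab; exact/mem_set.
Qed.

Lemma within_continuous_primitive (a b : R) (h : R -> R) : a <= b ->
  ess_bounded setT h -> (forall s, s \notin `[a, b] -> h s = 0) ->
  {within `[a, b], continuous (fun s => \int[mu]_(r in `]-oo, s]) h r)}.
Proof.
move=> ab bh h0; have hE := restrict_id h0.
have bhI : ess_bounded `[a, b] h by apply: ess_boundedS bh.
apply: within_continuous_eq (ess_bounded_primitive ab bhI) => s sab.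
by rewrite -[in RHS]hE Rintegral_restrict_primitive.
Qed.

(** The domain [T] is left general: it is the time axis for the dynamics, and the plane of time and
    variation parameter for the uniform bound on the Jacobian. *)
Lemma C1_in_x_within f (T0 T1 : R) (T : topologicalType) (A : set T)
    (y : T -> 'rV[R]_n) (c : T -> R) : C1_in_x f T0 T1 ->
  {within A, continuous y} -> {within A, continuous c} ->
  (forall s, A s -> c s \in `[T0, T1]) ->
  {within A, continuous (fun s => f (y s) (c s))} /\
  {within A, continuous (fun s => jacobian_x f (y s) (c s))}.
Proof.
move=> [cf _ cJ] cy cc cA; have cyc := within_continuous_pair cy cc.
split; first exact: (within_continuous_comp_within cyc cA cf).
exact: (within_continuous_comp_within cyc cA cJ).
Qed.

(** The primitive of [h] starts at -oo, so one formula serves at all times. If [h] has integral 0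
    and is supported in a stage, the primitive vanishes outside that stage. *)
Definition varied_state x (h : R -> R) (j : 'I_n) (e : R) (s : R) : 'rV[R]_n :=
  x s + e *: ((\int[mu]_(r in `]-oo, s]) h r) *: delta_mx 0 j).

(** The residual of the varied state, with the derivative of [x] written as [f (x s) s + u s] so
    that it is defined at every time. *)
Definition varied_control f x u (h : R -> R) (j : 'I_n) (e : R) (s : R) :
    'rV[R]_n :=
  u s + f (x s) s - f (varied_state x h j e s) s + (e * h s) *: delta_mx 0 j.

Lemma varied_controlE f x u h j e s k : varied_control f x u h j e s 0 k =
  u s 0 k + (f (x s) s 0 k - f (varied_state x h j e s) s 0 k)
    + e * ((j == k)%:R * h s).
Proof. by rewrite !mxE /= addrA [k == j]eq_sym; ring. Qed.

Context f (T0 T1 a b : R) (fC1 : C1_in_x f T0 T1).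
Context (ab : a < b) (aT0 : T0 <= a) (bT1 : b <= T1).

Let sub_stage s : s \in `[a, b] -> s \in `[T0, T1].
Proof.
rewrite !in_itv /= => /andP[sa sb].
by rewrite (le_trans aT0 sa) (le_trans sb bT1).
Qed.

Lemma within_continuous_varied_state x h j e :
  {within `[a, b], continuous x} -> ess_bounded setT h ->
  (forall s, s \notin `[a, b] -> h s = 0) ->
  {within `[a, b], continuous (varied_state x h j e)}.
Proof.
move=> cx bh h0 s; apply: cvgD; first exact: cx.
apply: cvgZl_tmp; apply: cvgZr_tmp.
exact: (within_continuous_primitive (ltW ab) bh h0).
Qed.

Lemma within_continuous_rhs y k : {within `[a, b], continuous y} ->
  {within `[a, b], continuous (fun s => f (y s) s 0 k)}.
Proof.
move=> cy; have [cf _] := C1_in_x_within fC1 cy (@within_continuous_id _ _) sub_stage.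
exact: within_continuous_coord cf.
Qed.

Lemma within_continuous_jacobian y k j : {within `[a, b], continuous y} ->
  {within `[a, b], continuous (fun s => jacobian_x f (y s) s k j)}.
Proof.
move=> cy; have [_ cJ] := C1_in_x_within fC1 cy (@within_continuous_id _ _) sub_stage.
exact: within_continuous_coord cJ.
Qed.

(** At fixed s the varied state runs along a line in direction j, which selects column j of f_x. *)
Lemma is_derive_varied_state x (h : R -> R) j (s tau : R) k : s \in `[a, b] ->
  is_derive tau 1 (fun e : R => f (varied_state x h j e s) s 0 k)
    ((\int[mu]_(r in `]-oo, s]) h r)
      * jacobian_x f (varied_state x h j tau s) s k j).
Proof.
move=> /sub_stage sT; have [_ df _] := fC1.
have := @is_derive_line _ _ (f^~ s) (x s)
  ((\int[mu]_(r in `]-oo, s]) h r) *: delta_mx 0 j) tau k (df s sT).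
rewrite -scalemxAl -rowE; congr (is_derive _ _ _ _).
by rewrite !mxE.
Qed.

(** A continuous function of (s, tau) is bounded on the compact rectangle [a, b] x [0, 1]. The bound
    serves to dominate the difference quotients of [f], whose steps 1 / (m + 1) lie in [0, 1]. *)
Lemma varied_state_jacobian_bounded x h j :
  {within `[a, b], continuous x} -> ess_bounded setT h ->
  (forall s, s \notin `[a, b] -> h s = 0) ->
  exists M, forall s tau k, s \in `[a, b] -> tau \in `[0, 1] ->
    `|(\int[mu]_(r in `]-oo, s]) h r)
      * jacobian_x f (varied_state x h j tau s) s k j| <= M.
Proof.
move=> cx bh h0.
pose A : set (R * R) := `[a, b]%classic `*` `[0, 1]%classic.
have c1 : {within A, continuous (@fst R R)}.
  by apply: continuous_subspaceT => s; exact: cvg_fst.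
have c2 : {within A, continuous (@snd R R)}.
  by apply: continuous_subspaceT => s; exact: cvg_snd.
pose phi s := \int[mu]_(r in `]-oo, s]) h r.
have cphi : {within A, continuous (phi \o fst)}.
  have cp := within_continuous_primitive (ltW ab) bh h0.
  by apply: (within_continuous_comp_within c1 _ cp) => z [].
have cxA : {within A, continuous (x \o fst)}.
  by apply: (within_continuous_comp_within c1 _ cx) => z [].
have cy : {within A, continuous (fun z => varied_state x h j z.2 z.1)}.
  move=> z; apply: cvgD; first exact: cxA.
  by apply: cvgZ; [exact: c2|apply: cvgZr_tmp; exact: cphi].
have [_ cJ] := C1_in_x_within fC1 cy c1 (fun z Az => sub_stage Az.1).
have bk k : exists M, forall z, A z ->
    `|phi z.1 * jacobian_x f (varied_state x h j z.2 z.1) z.1 k j| <= M.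
  have cg : {within A, continuous
      (fun z => phi z.1 * jacobian_x f (varied_state x h j z.2 z.1) z.1 k j)}.
    move=> z; apply: cvgM; first exact: cphi.
    exact: (@within_continuous_coord _ _ _ _ _ k j cJ z).
  have cA : compact A by apply: compact_setX; exact: segment_compact.
  have /compact_bounded[M [_ HM]] := continuous_compact cg cA.
  exists (`|M| + 1) => z Az; apply: HM; last by exists z.
  by rewrite ltr_pwDr// ler_norm.
have [M HM] := choice bk.
(* The sum bounds all components at once. *)
exists (\sum_k `|M k|) => s tau k sab t01.
apply: (@le_trans _ _ `|M k|).
  rewrite (le_trans _ (ler_norm _))//; exact: (HM k (s, tau)).
by rewrite (bigD1 k)//= lerDl sumr_ge0.
Qed.

End StageVariation.

(** * Difference quotients in the variation parameter *)

Section DifferenceQuotients.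
Context {R : realType}.

(** By the mean value theorem the quotient is a value of the derivative. *)
Lemma normr_difference_quotient_le (g dg : R -> R) (e M : R) : 0 < e ->
  (forall r : R, is_derive r 1 g (dg r)) ->
  (forall r, r \in `[0, e] -> `|dg r| <= M) ->
  `|e^-1 * (g e - g 0)| <= M.
Proof.
move=> e0 dgr dgM.
have cg : {within `[0, e], continuous g}.
  by apply: derivable_within_continuous => r _; case: (dgr r).
have [c cI ->] := MVT_segment (ltW e0) (fun r _ => dgr r) cg.
by rewrite subr0 mulrC mulfK ?gt_eqF// dgM.
Qed.

Lemma cvg_difference_quotient_harmonic (g : R -> R) (l : R) :
  is_derive (0 : R) 1 g l ->
  m.+1%:R^-1^-1 * (g m.+1%:R^-1 - g 0) @[m --> \oo] --> l.
Proof.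
move=> [dv dE].
have H : h^-1 *: (g (h *: 1 + 0) - g 0) @[h --> 0^'] --> l.
  by rewrite -dE; exact: dv.
(* The steps are nonzero, so they tend to 0 in the punctured neighbourhoods that define the
   derivative. *)
have cH : (m.+1%:R^-1 : R) @[m --> \oo] --> 0^'.
  move=> P; rewrite /dnbhs /within/= => nP.
  have := @cvg_harmonic R _ nP; rewrite /nbhs/=.
  by apply: filterS => m /=; apply; rewrite invr_eq0 pnatr_eq0.
have := cvg_comp _ _ cH H.
by apply: cvg_trans; apply: near_eq_cvg; apply: nearW => m /=;
   rewrite addr0 [_ *: 1]mulr1.
Qed.

End DifferenceQuotients.

(** * The Euler-Lagrange equation on one stage *)

Section StageEulerLagrange.
Context {R : realType} {n : nat}.
Notation mu := (@lebesgue_measure R).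
Context (f : 'rV[R]_n -> R -> 'rV[R]_n) (T0 T1 a b : R) (fC1 : C1_in_x f T0 T1).
Context (ab : a < b) (aT0 : T0 <= a) (bT1 : b <= T1).
Context (x u : R -> 'rV[R]_n) (cx : {within `[a, b], continuous x}).
Context (bu : forall k, ess_bounded `[a, b] (fun s => u s 0 k)).

Lemma varied_state0 h (j : 'I_n) s : varied_state x h j 0 s = x s.
Proof. by rewrite /varied_state scale0r addr0. Qed.

(** Only positive e are compared, so the first variation comes out as an inequality; the reverse one
    will come from -h. *)
Lemma stage_weak_ge0 (h : R -> R) (j : 'I_n) :
  ess_bounded setT h -> (forall s, s \notin `[a, b] -> h s = 0) ->
  (forall e, 0 < e ->
    \int[mu]_(s in `[a, b]) (\sum_k u s 0 k ^+ 2) <=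
    \int[mu]_(s in `[a, b]) (\sum_k varied_control f x u h j e s 0 k ^+ 2)) ->
  0 <= \int[mu]_(s in `[a, b]) (u s 0 j * h s
    - (\sum_k u s 0 k * jacobian_x f (x s) s k j) * \int[mu]_(r in `]-oo, s]) h r).
Proof.
move=> bh h0 opt.
have bhI : ess_bounded `[a, b] h by apply: ess_boundedS bh.
have [M HM] := varied_state_jacobian_bounded fC1 ab aT0 bT1 j cx bh h0.
pose phi s := \int[mu]_(r in `]-oo, s]) h r.
pose y e s := varied_state x h j e s.
pose q (m : nat) k s :=
  m.+1%:R^-1^-1 * (f (y m.+1%:R^-1 s) s 0 k - f (y 0 s) s 0 k).
(* The change of the control divided by e = 1 / (m + 1), where [q] is the difference quotient of [f]
   along the varied state. *)
pose d_ m k s := (j == k)%:R * h s - q m k s.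
pose d k s := (j == k)%:R * h s - phi s * jacobian_x f (x s) s k j.
have dy s k (tau : R) : s \in `[a, b] ->
    is_derive tau 1 (fun e : R => f (y e s) s 0 k)
      (phi s * jacobian_x f (y tau s) s k j).
  by move=> sab; exact: (is_derive_varied_state fC1 aT0 bT1).
have qM m k s : s \in `[a, b] -> `|q m k s| <= M.
  move=> sab; have e0 : 0 < m.+1%:R^-1 :> R by rewrite invr_gt0.
  have e1 : m.+1%:R^-1 <= 1 :> R by rewrite invf_le1// ler1n.
  apply: (normr_difference_quotient_le e0 (fun tau => dy s k tau sab)).
  move=> tau tauI; apply: HM => //; move: tauI.
  by rewrite !in_itv /= => /andP[-> /le_trans->].
have cq m k : {within `[a, b], continuous (q m k)}.
  move=> s; apply: cvgMr; apply: cvgB.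
    apply: (within_continuous_rhs fC1 aT0 bT1).
    exact: within_continuous_varied_state.
  apply: (within_continuous_rhs fC1 aT0 bT1).
  exact: within_continuous_varied_state.
have main := @first_variation_ge0 R a b n (fun k s => u s 0 k) d d_
  (fun s => `|h s| + M) bu.
(* In the pairing of [u] with [d] the Kronecker symbol leaves u_j h, and the remaining sum is (f_x^T
   u)_j times the primitive of [h]. *)
suff : 0 <= \int[mu]_(s in `[a, b]) \sum_k u s 0 k * d k s.
  congr (0 <= _); apply: eq_Rintegral => s _; rewrite /d.
  under eq_bigr do rewrite mulrBr; rewrite sumrB; congr (_ - _).
    rewrite (bigD1 j)//= eqxx mul1r big1 ?addr0// => k kj.
    by rewrite eq_sym (negbTE kj) mul0r mulr0.
  by rewrite mulr_suml; apply: eq_bigr => k _; rewrite -/(phi s); ring.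
apply: main.
- move=> m k; apply: measurable_funB; first exact: measurable_funM bhI.1.
  by have [] := ess_bounded_continuous (cq m k).
- by apply: ess_boundedD; [exact: ess_bounded_norm|exact: ess_bounded_cst].
- move=> m k s sab; rewrite (le_trans (ler_normB _ _))// lerD ?qM//.
  by rewrite normrM; case: (j == k); rewrite /= ?normr1 ?normr0 ?mul1r ?mul0r.
- move=> k s sab; apply: cvgB; first exact: cvg_cst.
  rewrite -[x s](varied_state0 h j).
  exact: cvg_difference_quotient_harmonic (dy s k 0 sab).
- move=> m; have e0 : 0 < m.+1%:R^-1 :> R by rewrite invr_gt0.
  have := opt _ e0; congr (_ <= _); apply: eq_Rintegral => s _.
  apply: eq_bigr => k _; rewrite varied_controlE /d_ /q; congr (_ ^+ 2).
  rewrite {2}/y varied_state0 -/(y _ _) mulrBr (mulVKf (lt0r_neq0 e0)); ring.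
Qed.

(** The weak inequality for both h and -h is an equality, to which du Bois-Reymond applies with p =
    u_j and q = (f_x^T u)_j. *)
Lemma stage_euler_lagrange :
  (forall (h : R -> R) j e, ess_bounded setT h ->
    (forall s, s \notin `[a, b] -> h s = 0) -> \int[mu]_s h s = 0 -> 0 < e ->
    \int[mu]_(s in `[a, b]) (\sum_k u s 0 k ^+ 2) <=
    \int[mu]_(s in `[a, b]) (\sum_k varied_control f x u h j e s 0 k ^+ 2)) ->
  forall j, exists c, \forall s \ae mu, s \in `[a, b] ->
    u s 0 j = c - \int[mu]_(r in `[a, s])
      (\sum_k u r 0 k * jacobian_x f (x r) r k j).
Proof.
move=> opt j; pose q s := \sum_k u s 0 k * jacobian_x f (x s) s k j.
have bq : ess_bounded `[a, b] q.
  apply: ess_bounded_sum => k; apply: ess_boundedM => //.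
  by apply: ess_bounded_continuous; exact: (within_continuous_jacobian fC1).
apply: (@du_bois_reymond _ a b (fun s => u s 0 j) q ab (bu j) bq) => h bh h0 ih0.
have bhI : ess_bounded `[a, b] h by apply: ess_boundedS bh.
have bhN := ess_boundedN bh.
have h0N s : s \notin `[a, b] -> - h s = 0 by move=> /h0 ->; rewrite oppr0.
have ih : mu.-integrable setT (EFin \o h).
  by rewrite -(restrict_id h0); exact: ess_bounded_integrableT.
have NE D : measurable D -> \int[mu]_(s in D) (- h s) = - \int[mu]_(s in D) h s.
  move=> mD; under eq_Rintegral do rewrite -mulN1r.
  by rewrite RintegralZl ?mulN1r//; exact: integrableS ih.
pose phi s := \int[mu]_(r in `]-oo, s]) h r.
have bphi : ess_bounded `[a, b] phi.
  by apply: ess_bounded_continuous; exact: (within_continuous_primitive (ltW ab)).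
have buh : ess_bounded `[a, b] (fun s => u s 0 j * h s) by exact: ess_boundedM.
have bqphi : ess_bounded `[a, b] (fun s => q s * phi s) by exact: ess_boundedM.
have iuh := ess_bounded_integrable_itv buh.
have iqphi := ess_bounded_integrable_itv bqphi.
have W1 := stage_weak_ge0 bh h0 (fun e => opt h j e bh h0 ih0).
have ihN0 : \int[mu]_s (- h s) = 0 by rewrite NE// ih0 oppr0.
(* The opposite test function is admissible too and yields the reverse inequality. *)
have W2 := stage_weak_ge0 bhN h0N (fun e => opt _ j e bhN h0N ihN0).
apply/eqP; rewrite -subr_eq0 -RintegralB// eq_le W1 andbT -oppr_ge0.
move: W2; congr (0 <= _).
rewrite -mulN1r -RintegralZl//.
  by apply: eq_Rintegral => s _; rewrite NE// -/(q s) -/(phi s); ring.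
by apply: ess_bounded_integrable_itv; apply: ess_boundedD => //; exact: ess_boundedN.
Qed.

End StageEulerLagrange.

(** * Derivatives at every time of primitives of continuous functions *)

Section PrimitiveDerivative.
Context {R : realType}.
Notation mu := (@lebesgue_measure R).

(** Extending [g] continuously to the whole line makes every point of [a, b] interior, so the
    fundamental theorem of calculus covers the endpoints as well. *)
Lemma primitive_difference_quotient (a b : R) (g G : R -> R) : a <= b ->
  {within `[a, b], continuous g} ->
  (forall s, s \in `[a, b] -> G s = G a + \int[mu]_(r in `[a, s]) g r) ->
  forall s, s \in `[a, b] ->
    (r - s)^-1 * (G r - G s) @[r --> within (`[a, b] `\ s) (nbhs s)] --> g s.
Proof.
move=> ab cg GE s sab.
(* The projection onto [a, b]: [g \o cl] extends [g] by its two endpoint values. *)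
pose cl r : R := Num.max a (Num.min b r).
have clI r : `[a, b]%classic (cl r).
  by rewrite /= in_itv /= le_max lexx ge_max ab ge_min lexx.
have clE r : r \in `[a, b] -> cl r = r.
  by rewrite in_itv /= => /andP[ar rb]; rewrite /cl min_r// max_r.
have ccl : continuous cl.
  move=> r; apply: (@continuous_max _ _ (cst a) (fun r => Num.min b r)).
    exact: cvg_cst.
  by apply: (@continuous_min _ _ (cst b) id); [exact: cvg_cst|exact: cvg_id].
have cgcl : continuous (g \o cl).
  have : {within setT, continuous (g \o cl)}.
    apply: (within_continuous_comp_within _ (fun r _ => clI r) cg).
    exact: continuous_subspaceT.
  by move=> H; apply/continuous_subspace_setT; exact: H.
have igcl l r : mu.-integrable `[l, r] (EFin \o (g \o cl)).
  apply: continuous_compact_integrable; first exact: segment_compact.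
  exact: continuous_subspaceT.
(* The base point lies strictly to the left of [a], so that s = a is interior too. *)
pose P r := \int[mu]_(y in `[a - 1, r]) (g \o cl) y.
have PE r : r \in `[a, b] -> P r = P a + (G r - G a).
  move=> rab; rewrite GE// addrAC subrr add0r; apply/eqP; rewrite addrC -subr_eq.
  move: (rab); rewrite in_itv /= => /andP[ar rb].
  rewrite /P Rintegral_itvB ?bnd_simp//; last by rewrite gerBl.
  rewrite Rintegral_itv_obnd_cbnd; last first.
    by apply: integrableS (igcl a r) => //; exact: subset_itv_oc_cc.
  apply/eqP; apply: eq_Rintegral => y /set_mem /=; rewrite in_itv /= => /andP[ay yr].
  by rewrite clE// in_itv /= ay (le_trans yr).
move: (sab); rewrite in_itv /= => /andP[sa sb].
have [|||dP PEs] := @continuous_FTC1_closed _ (g \o cl) (a - 1) s (s + 1) _ (igcl _ _).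
- by rewrite ltrDl.
- by rewrite (lt_le_trans _ sa)// gtrBl.
- exact: cgcl.
have H : h^-1 *: (P (h *: 1 + s) - P s) @[h --> 0^'] --> g s.
  by have := PEs; rewrite /= clE// derive1E => <-; exact: dP.
(* Restricting r to the stage gives the one-sided quotient at an endpoint. *)
have rs : (r - s) @[r --> within (`[a, b] `\ s) (nbhs s)] --> 0^'.
  move=> U; rewrite /dnbhs /within/= => nU.
  have cs : {for s, continuous (fun r : R => r - s)}.
    by apply: continuousB; [exact: cvg_id|exact: cst_continuous].
  rewrite -(subrr s) in nU; move: (cs _ nU).
  apply: (@filterS _ (nbhs s)) => r rU [_ rs].
  by apply: rU; apply/eqP; rewrite /= subrr => /eqP; rewrite subr_eq0 => /eqP.
have := cvg_comp _ _ rs H; apply: cvg_trans; apply: near_eq_cvg.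
rewrite near_withinE; apply: nearW => r [rab _] /=.
have PG : P r - P s = G r - G s by rewrite PE// (PE s)//; ring.
by rewrite [_ *: 1]mulr1 subrK PG.
Qed.

Lemma has_derivative_on_primitive (n : nat) (a b : R) (g G : R -> 'rV[R]_n) :
  a <= b -> {within `[a, b], continuous g} ->
  (forall s, s \in `[a, b] -> forall j,
    G s 0 j = G a 0 j + \int[mu]_(r in `[a, s]) g r 0 j) ->
  forall s, s \in `[a, b] -> has_derivative_on `[a, b] G s (g s).
Proof.
move=> ab cg GE s sab; apply: cvg_mx => i j; rewrite ord1.
have := @primitive_difference_quotient a b (fun s => g s 0 j) (fun s => G s 0 j)
  ab (@within_continuous_coord _ _ _ _ _ _ 0 j cg) (fun r rab => GE r rab j) s sab.
by apply: cvg_trans; apply: near_eq_cvg; apply: nearW => r; rewrite !mxE.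
Qed.

End PrimitiveDerivative.

(** * Primitives from minus infinity *)

Section Primitive.
Context {R : realType}.
Notation mu := (@lebesgue_measure R).
Implicit Types (a b s : R) (h : R -> R).

Lemma primitive_left a b h s : a <= b -> (forall s, s \notin `[a, b] -> h s = 0) ->
  s <= a -> \int[mu]_(r in `]-oo, s]) h r = 0.
Proof.
move=> ab h0; rewrite le_eqVlt => /predU1P[->|sa].
  rewrite -(restrict_id h0) Rintegral_restrict_primitive.
    by rewrite set_itv1 Rintegral_set1.
  by rewrite in_itv /= lexx.
transitivity (\int[mu]_(r in `]-oo, s]) (cst 0 : R -> R) r).
  apply: eq_Rintegral => r /set_mem /=; rewrite in_itv /= => rs.
  by rewrite h0// in_itv /= negb_and -ltNge (le_lt_trans rs).
by rewrite Rintegral_cst// mul0r.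
Qed.

Lemma primitive_right a b h s : a <= b -> (forall s, s \notin `[a, b] -> h s = 0) ->
  b <= s -> \int[mu]_(r in `]-oo, s]) h r = \int[mu]_r h r.
Proof.
move=> ab h0 bs; rewrite -[X in _ = Rintegral _ _ X](restrict_id h0).
rewrite -[X in Rintegral _ _ X = _](restrict_id h0).
rewrite -Rintegral_mkcondr -Rintegral_mkcond; congr (Rintegral _ _ _).
apply/seteqP; split => r /=; first by case.
move=> rab; split=> //; move: rab; rewrite !in_itv /= => /andP[_ rb].
exact: le_trans bs.
Qed.

Lemma primitiveB h r s : mu.-integrable setT (EFin \o h) -> r <= s ->
  \int[mu]_(y in `]-oo, s]) h y
  = \int[mu]_(y in `]-oo, r]) h y + \int[mu]_(y in `[r, s]) h y.
Proof.
move=> ih rs; have iS D : measurable D -> mu.-integrable D (EFin \o h).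
  by move=> mD; apply: integrableS ih.
rewrite -Rintegral_itv_obnd_cbnd; last exact: iS.
rewrite -(@Rintegral_itvB _ h -oo%O (BRight s) r)//; last exact: iS.
by rewrite addrC subrK.
Qed.

(** Lebesgue differentiation: it gives the a.e. derivative both of the variation and of the
    coordinates of W^{1,oo} curves. *)
Lemma primitive_is_derive_ae h : mu.-integrable setT (EFin \o h) ->
  \forall s \ae mu, 
    is_derive (s : R) 1 (fun s : R => \int[mu]_(r in `]-oo, s]) h r) (h s).
Proof.
move=> ih; have iS D : measurable D -> mu.-integrable D (EFin \o h).
  by move=> mD; apply: integrableS ih.
have lh : locally_integrable [set: R] h.
  have := integrable_locally measurableT ih.
  by rewrite patch_setT.
pose F (s : R) := \int[mu]_(r in `]-oo, s]) h r.
have dF : \forall s \ae mu, derivable F s 1 /\ derive1 F s = h s.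
  exact: (FTC1Ny (fun y => iS _ (measurable_itv _)) lh).
apply: filterS dF => s [ds Es]; split; first exact: ds.
by rewrite -derive1E.
Qed.

End Primitive.

(** * The classes L^oo and W^{1,oo} on a stage *)

Section Linfty.
Context {R : realType} {n : nat}.
Notation mu := (@lebesgue_measure R).

Lemma Linfty_ess_bounded (a b : R) (u : R -> 'rV[R]_n) :
  Linfty a b u <-> forall j, ess_bounded `[a, b] (fun s => u s 0 j).
Proof.
by split=> H j; [apply/ess_bounded_restrict => //; exact/ess_bounded_Lfun|
  apply/ess_bounded_Lfun; apply/(ess_bounded_restrict _ _).1].
Qed.

Lemma W1infty_within_continuous (a b : R) (x : R -> 'rV[R]_n) : a <= b ->
  W1infty a b x -> {within `[a, b], continuous x}.
Proof.
move=> ab [v [/Linfty_ess_bounded bv xE]].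
apply: within_continuous_rV => j.
have H : {within `[a, b], continuous
    (fun s => x a 0 j + \int[mu]_(r in `[a, s]) v r 0 j)}.
  by move=> s; apply: cvgD; [exact: cst_continuous|exact: ess_bounded_primitive].
by apply: within_continuous_eq H => s sab; rewrite -xE.
Qed.

(** Near an interior point each coordinate of [x] is a constant plus the primitive of v_j extended
    by 0, so the weak and the classical derivative agree a.e. The representation fails beyond the
    endpoints, hence the open interval. *)
Lemma W1infty_derivative_ae (a b : R) (x v D : R -> 'rV[R]_n) : Linfty a b v ->
  (forall s, s \in `[a, b] -> forall j,
    x s 0 j = x a 0 j + \int[mu]_(r in `[a, s]) v r 0 j) ->
  (\forall s \ae mu, s \in `[a, b] -> is_derive s 1 x (D s)) ->
  \forall s \ae mu, s \in `]a, b[ -> v s = D s.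
Proof.
move=> /Linfty_ess_bounded bv xE dx.
have : \forall s \ae mu, forall j, s \in `]a, b[ -> v s 0 j = D s 0 j.
  apply: filter_forall => j.
  have ip := ess_bounded_integrableT (bv j).
  apply: filterS2 (primitive_is_derive_ae ip) dx => s dp dx sab.
  have {}dx := dx (subset_itv_oo_cc sab).
  set p := (_ \_ _) in dp *.
  have ps : p s = v s 0 j by rewrite /p patchE mem_set//=; exact: subset_itv_oo_cc.
  have -> : D s 0 j = 'D_1 (fun r => x r 0 j) s.
    have ddx : derivable x s 1 by case: dx.
    have := derive_mx ddx; rewrite (@derive_val _ _ _ _ _ _ _ dx) => ->.
    by rewrite mxE.
  rewrite -ps -(@derive_val _ _ _ _ _ _ _ dp).
  rewrite -[LHS](add0r) -(derive_cst (x a 0 j) s 1) -deriveD//.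
  apply: near_eq_derive; have := near_in_itvoo sab; apply: filterS => r rab.
  have {}rab := subset_itv_oo_cc rab.
  by rewrite [RHS]xE// /p; congr (_ + _); exact: Rintegral_restrict_primitive.
apply: filterS => s vD sab; apply/rowP => j; exact: vD.
Qed.

Lemma enorm_sqr (w : 'rV[R]_n) : enorm w ^+ 2 = \sum_j w 0 j ^+ 2.
Proof. by rewrite sqr_sqrtr// sumr_ge0// => j _; exact: sqr_ge0. Qed.

Lemma is_derive_scale_cst (phi : R -> R) (s d : R) (w : 'rV[R]_n) :
  is_derive s 1 phi d -> is_derive s 1 (fun r : R => phi r *: w) (d *: w).
Proof.
move=> [dv dE].
have H : h^-1 *: (phi (h *: 1 + s) *: w - phi s *: w) @[h --> 0^'] --> d *: w.
  under eq_fun do rewrite -scalerBl scalerA.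
  by apply: cvgZr_tmp; rewrite -dE; exact: dv.
have dw : derivable (fun r : R => phi r *: w) s 1 by apply/cvg_ex; exists (d *: w).
by split=> //; apply: cvg_lim.
Qed.

End Linfty.

(** * Feasibility of the varied pair *)

Section Feasibility.
Context {R : realType} {n N : nat}.
Notation mu := (@lebesgue_measure R).
Context (f : 'rV[R]_n -> R -> 'rV[R]_n) (t : nat -> R) (z : nat -> 'rV[R]_n).
Context (x u : R -> 'rV[R]_n).
Context (t_lt : forall i : nat, (i < N)%N -> t i < t i.+1).
Context (f_C1 : C1_in_x f (t 0%N) (t N)).

Lemma node_le i j : (i <= j <= N)%N -> t i <= t j.
Proof.
elim: j => [|j IH]; first by rewrite leqn0 => /andP[/eqP->].
move=> /andP[]; rewrite leq_eqVlt => /predU1P[-> //|ij jN].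
by apply: le_trans (IH _) (ltW (t_lt jN)); rewrite -ltnS ij ltnW.
Qed.

Lemma stage_ge0 i : (i < N)%N -> t 0%N <= t i.
Proof. by move=> iN; apply: node_le; rewrite leq0n ltnW. Qed.

Lemma stage_leN i : (i < N)%N -> t i.+1 <= t N.
Proof. by move=> iN; apply: node_le; rewrite iN leqnn. Qed.

Lemma Linfty_varied_control (a b : R) (h : R -> R) j e :
  a < b -> t 0%N <= a -> b <= t N ->
  {within `[a, b], continuous x} ->
  {within `[a, b], continuous (varied_state x h j e)} ->
  ess_bounded setT h -> Linfty a b u -> Linfty a b (varied_control f x u h j e).
Proof.
move=> ab a0 bN cx cy bh /Linfty_ess_bounded bu; apply/Linfty_ess_bounded => k.
have bhI : ess_bounded `[a, b] h by apply: ess_boundedS bh.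
have bf y : {within `[a, b], continuous y} ->
    ess_bounded `[a, b] (fun s => f (y s) s 0 k).
  by move=> cy'; apply: ess_bounded_continuous; exact: (within_continuous_rhs f_C1).
have -> : (fun s => varied_control f x u h j e s 0 k) = (fun s => u s 0 k +
    (f (x s) s 0 k + - f (varied_state x h j e s) s 0 k) + e * ((j == k)%:R * h s)).
  by apply/funext => s; rewrite varied_controlE.
have bc c : ess_bounded `[a, b] (fun=> c) by exact: ess_bounded_cst.
apply: ess_boundedD; last by do 2 apply: ess_boundedM => //.
apply: ess_boundedD => //; apply: ess_boundedD; first exact: bf.
by apply: ess_boundedN; exact: bf.
Qed.

Context (xu_feas : PL2_feasible N f t z x u).
Context (i : nat) (iN : (i < N)%N) (h : R -> R) (bh : ess_bounded setT h).
Context (h0 : forall s, s \notin `[t i, t i.+1] -> h s = 0).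
Context (ih0 : \int[mu]_s h s = 0) (j : 'I_n) (e : R).

Let ab : t i <= t i.+1. Proof. exact/ltW/t_lt. Qed.

Let integrable_h : mu.-integrable setT (EFin \o h).
Proof.
rewrite -(restrict_id h0); apply: ess_bounded_integrableT.
exact: ess_boundedS bh.
Qed.

(** The primitive of [h] is 0 up to the left node and equals the total integral, again 0, from the
    right node on. *)
Lemma varied_state_outside s : s <= t i \/ t i.+1 <= s ->
  varied_state x h j e s = x s.
Proof.
rewrite /varied_state => -[sa|bs].
  by rewrite (primitive_left ab h0 sa) scale0r scaler0 addr0.
by rewrite (primitive_right ab h0 bs) ih0 scale0r scaler0 addr0.
Qed.

(** The inequalities are strict because [h] may be nonzero at the nodes of its stage. *)
Lemma varied_control_outside s : s < t i \/ t i.+1 < s ->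
  varied_control f x u h j e s = u s.
Proof.
move=> sout; have -> : varied_control f x u h j e s =
    u s + f (x s) s - f (x s) s + (e * h s) *: delta_mx 0 j.
  by rewrite -[in X in _ - f X s](varied_state_outside (s := s))//;
     case: sout => /ltW; [left|right].
rewrite addrK h0 ?mulr0 ?scale0r ?addr0//.
by rewrite in_itv /= negb_and -!ltNge; case: sout => ->; rewrite ?orbT.
Qed.

Lemma W1infty_varied_state k : (k < N)%N ->
  W1infty (t k) (t k.+1) (varied_state x h j e).
Proof.
move=> kN; have [/(_ _ kN)[[v [/Linfty_ess_bounded bv xE]] _] _ _] := xu_feas.
(* The weak derivative of [x] plus that of the variation. *)
exists (fun s => v s + (e * h s) *: delta_mx 0 j); split.
  apply/Linfty_ess_bounded => l.
  have -> : (fun s => (v s + (e * h s) *: delta_mx 0 j) 0 l) =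
      (fun s => v s 0 l + e * h s * (l == j)%:R).
    by apply/funext => s; rewrite !mxE.
  apply: ess_boundedD => //; apply: ess_boundedM; last exact: ess_bounded_cst.
  apply: ess_boundedM; first exact: ess_bounded_cst.
  exact: ess_boundedS bh.
move=> s sI l; have := sI; rewrite in_itv /= => /andP[ks sk].
rewrite !mxE xE// (primitiveB integrable_h ks).
have iS : mu.-integrable `[t k, s] (EFin \o h) by apply: integrableS integrable_h.
have iv : mu.-integrable `[t k, s] (EFin \o (fun r => v r 0 l)).
  apply: ess_bounded_integrable_itv; apply: ess_boundedS (bv l) => //.
  by apply: subset_itvl; rewrite bnd_simp.
have -> : \int[mu]_(r in `[t k, s]) (v r + (e * h r) *: delta_mx 0 j) 0 l =
    \int[mu]_(r in `[t k, s]) (v r 0 l + (e * (l == j)%:R) * h r).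
  by apply: eq_Rintegral => r _; rewrite !mxE; ring.
have ieh : mu.-integrable `[t k, s] (EFin \o (fun r => (e * (l == j)%:R) * h r)).
  exact: (integrableZl _ (e * (l == j)%:R) iS).
rewrite RintegralD// RintegralZl// eqxx /=; ring.
Qed.

(** The differential equation holds by the choice of the control wherever the primitive of [h] has
    derivative [h]. No node is interior to stage [i], so the interpolation conditions survive. *)
Lemma PL2_feasible_varied :
  PL2_feasible N f t z (varied_state x h j e) (varied_control f x u h j e).
Proof.
have [xuW xu_d xz] := xu_feas; split.
- move=> k kN; have W := W1infty_varied_state kN; split=> //.
  have [xW uL] := xuW k kN; have kk := t_lt kN.
  apply: Linfty_varied_control => //.
  + exact: stage_ge0.
  + exact: stage_leN.
  + exact: W1infty_within_continuous (ltW kk) xW.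
  + exact: W1infty_within_continuous (ltW kk) W.
- apply: filterS2 xu_d (primitive_is_derive_ae integrable_h) => s dx dphi sI.
  have {}dx := dx sI.
  have dw := is_derive_scale_cst (delta_mx 0 j : 'rV[R]_n) dphi.
  have := is_deriveD dx (is_deriveZ e dw).
  congr (is_derive _ _ _ _).
  rewrite /varied_control scalerA; set F := f (varied_state _ _ _ _ _) _.
  by rewrite [RHS]addrA [F + _]addrC subrK [u s + _]addrC.
- move=> k kN; rewrite varied_state_outside ?xz//.
  have [ki|ik] := leqP k i.
    by left; apply: node_le; rewrite ki ltnW.
  by right; apply: node_le; rewrite ik.
Qed.

End Feasibility.

(** * Optimality and the boundary-value problem stage by stage *)

Section Optimality.
Context {R : realType} {n N : nat}.
Notation mu := (@lebesgue_measure R).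

Lemma Linfty_sqr_ess_bounded (a b : R) (u : R -> 'rV[R]_n) : Linfty a b u ->
  ess_bounded `[a, b] (fun s => \sum_k u s 0 k ^+ 2).
Proof.
move=> /Linfty_ess_bounded bu; apply: ess_bounded_sum => k.
exact: ess_bounded_sqr.
Qed.

Lemma stage_costE (a b : R) (u : R -> 'rV[R]_n) : Linfty a b u ->
  (\int[mu]_(s in `[a, b]) (enorm (u s) ^+ 2)%:E
  = (\int[mu]_(s in `[a, b]) (\sum_k u s 0 k ^+ 2))%:E)%E.
Proof.
move=> /Linfty_sqr_ess_bounded bu; under eq_integral do rewrite enorm_sqr.
rewrite -[LHS]fineK//; apply: integrable_fin_num => //.
exact: ess_bounded_integrable_itv bu.
Qed.

(** Costs of L^oo controls are finite, so common terms can be cancelled in the reals. *)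
Lemma PL2_costE (t : nat -> R) (u : R -> 'rV[R]_n) :
  (forall i, (i < N)%N -> Linfty (t i) (t i.+1) u) ->
  PL2_cost N t u = (2^-1 * \sum_(i < N)
    \int[mu]_(s in `[t i, t i.+1]) (\sum_k u s 0 k ^+ 2))%:E.
Proof.
move=> bu; rewrite /PL2_cost EFinM -sumEFin; congr (_ * _)%E.
by apply: eq_bigr => i _; rewrite stage_costE//; exact: bu.
Qed.

Lemma ae_neq (a : R) : \forall s \ae mu, s != a.
Proof.
exists [set a]; split => //; first exact: lebesgue_measure_set1.
by move=> s /= /negP; rewrite negbK => /eqP.
Qed.

Context (f : 'rV[R]_n -> R -> 'rV[R]_n) (t : nat -> R) (z : nat -> 'rV[R]_n).
Context (x u : R -> 'rV[R]_n).
Context (t_lt : forall i : nat, (i < N)%N -> t i < t i.+1).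
Context (f_C1 : C1_in_x f (t 0%N) (t N)).
Context (xu_sol : PL2_solution N f t z x u).

(** The variation leaves the cost of every other stage unchanged, so global optimality localizes to
    stage [i]. *)
Lemma PL2_stage_le (i : nat) (h : R -> R) (j : 'I_n) (e : R) : (i < N)%N ->
  ess_bounded setT h -> (forall s, s \notin `[t i, t i.+1] -> h s = 0) ->
  \int[mu]_s h s = 0 ->
  \int[mu]_(s in `[t i, t i.+1]) (\sum_k u s 0 k ^+ 2) <=
  \int[mu]_(s in `[t i, t i.+1])
    (\sum_k varied_control f x u h j e s 0 k ^+ 2).
Proof.
move=> iN bh h0 ih0; have [xu_feas opt] := xu_sol.
have vf := PL2_feasible_varied t_lt f_C1 xu_feas iN bh h0 ih0 j e.
have uL k : (k < N)%N -> Linfty (t k) (t k.+1) u.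
  by move=> kN; have [/(_ _ kN)[]] := xu_feas.
have vL k : (k < N)%N -> Linfty (t k) (t k.+1) (varied_control f x u h j e).
  by move=> kN; have [/(_ _ kN)[]] := vf.
have := opt _ _ vf; rewrite !PL2_costE// lee_fin ler_pM2l ?invr_gt0//.
rewrite (bigD1 (Ordinal iN))//= [leRHS](bigD1 (Ordinal iN))//=.
suff -> : \sum_(k < N | k != Ordinal iN)
      \int[mu]_(s in `[t k, t k.+1]) (\sum_l u s 0 l ^+ 2)
    = \sum_(k < N | k != Ordinal iN) \int[mu]_(s in `[t k, t k.+1])
      (\sum_l varied_control f x u h j e s 0 l ^+ 2).
  by rewrite lerD2r.
apply: eq_bigr => k ki; apply: ess_bounded_ae_eq => //.
- exact/Linfty_sqr_ess_bounded/uL.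
- exact/Linfty_sqr_ess_bounded/vL.
(* A neighbouring stage shares a node with stage [i], where the controls may differ; both nodes are
   discarded as null sets. *)
apply: filterS2 (ae_neq (t i)) (ae_neq (t i.+1)) => s sa sb.
rewrite /= in_itv /= => /andP[ks sk].
rewrite (varied_control_outside f x u t_lt iN h0 ih0)//.
have {}ki : (k : nat) != i by move: ki; apply: contra => /eqP ki; exact/eqP/val_inj.
have [{}ki|] := ltnP k i.
  left; rewrite lt_neqAle sa (le_trans sk)//.
  by apply: (node_le t_lt); rewrite ki ltnW.
rewrite leq_eqVlt eq_sym (negbTE ki) /= => ik.
right; rewrite lt_neqAle eq_sym sb (le_trans _ ks)//.
by apply: (node_le t_lt); rewrite ik ltnW.
Qed.

(** The integrated Euler-Lagrange equation provides a continuous [q] with u = -q a.e. Substituting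
    it for [u] makes [x] and [q] primitives of continuous functions. *)
Lemma PL2_stage_bvp (i : nat) : (i < N)%N -> exists q : R -> 'rV[R]_n,
  [/\ \forall s \ae mu, s \in `[t i, t i.+1] -> u s = - q s,
      W1infty (t i) (t i.+1) q
    & stage_bvp f (t i) (t i.+1) (z i) (z i.+1) x q].
Proof.
move=> iN; have [[xuW xu_d xz] _] := xu_sol.
have [xW uL] := xuW i iN; have ab := t_lt iN.
have a0 := stage_ge0 t_lt iN; have bN := stage_leN t_lt iN.
set a := t i in xW uL ab a0 *; set b := t i.+1 in xW uL ab bN *.
have bu := (Linfty_ess_bounded _ _ _).1 uL.
have cx := W1infty_within_continuous (ltW ab) xW.
pose g s : 'rV[R]_n := \row_j \sum_k u s 0 k * jacobian_x f (x s) s k j.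
have EL := stage_euler_lagrange f_C1 ab a0 bN cx bu
  (fun h j e bh h0 ih0 _ => PL2_stage_le j e iN bh h0 ih0).
have [c uE] := choice EL.
(* The negative of the right-hand side of [uE], where [g] is f_x^T u. *)
pose q s : 'rV[R]_n := \row_j (\int[mu]_(r in `[a, s]) g r 0 j - c j).
have uq : \forall s \ae mu, s \in `[a, b] -> u s = - q s.
  have : \forall s \ae mu, forall j, s \in `[a, b] -> u s 0 j = c j -
      \int[mu]_(r in `[a, s]) \sum_k u r 0 k * jacobian_x f (x r) r k j.
    by apply: filter_forall => j; exact: uE.
  apply: filterS => s us sab; apply/rowP => j.
  rewrite us// !mxE opprB; congr (_ - _); apply: eq_Rintegral => r _.
  by rewrite mxE.
have bg j : ess_bounded `[a, b] (fun s => g s 0 j).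
  have -> : (fun s => g s 0 j) =
      (fun s => \sum_k u s 0 k * jacobian_x f (x s) s k j).
    by apply/funext => s; rewrite mxE.
  apply: ess_bounded_sum => k; apply: ess_boundedM => //.
  by apply: ess_bounded_continuous; exact: (within_continuous_jacobian f_C1).
have qE s j : q s 0 j = q a 0 j + \int[mu]_(r in `[a, s]) g r 0 j.
  by rewrite !mxE set_itv1 Rintegral_set1 sub0r addrC.
have qW : W1infty a b q by exists g; split=> //; exact/Linfty_ess_bounded.
have cq := W1infty_within_continuous (ltW ab) qW.
have sub_ae (s : R) (F G : R -> R) : s \in `[a, b] ->
    ess_bounded `[a, b] F -> ess_bounded `[a, b] G ->
    (\forall r \ae mu, r \in `[a, b] -> F r = G r) ->
    \int[mu]_(r in `[a, s]) F r = \int[mu]_(r in `[a, s]) G r.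
  rewrite in_itv /= => /andP[sa sb] bF bG FG.
  have sI : `[a, s]%classic `<=` `[a, b]%classic.
    by apply: subset_itvl; rewrite bnd_simp.
  apply: ess_bounded_ae_eq => //.
  - exact: ess_boundedS bF.
  - exact: ess_boundedS bG.
  - by apply: filterS FG => r FG /sI; exact: FG.
exists q; split=> //; split; [exact/xz/ltnW|exact: xz|].
have within_continuous_field : {within `[a, b], continuous (fun s => f (x s) s)}.
  by apply: within_continuous_rV => j; exact: (within_continuous_rhs f_C1).
(* The weak derivative of [x] equals f(x) + u a.e., hence the continuous f(x) - q. *)
have Dx : forall s, s \in `[a, b] -> has_derivative_on `[a, b] x s (f (x s) s - q s).
  have cF : {within `[a, b], continuous (fun s => f (x s) s - q s)}.
    by move=> s; apply: cvgB; [exact: within_continuous_field|exact: cq].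
  apply: (has_derivative_on_primitive (ltW ab) cF) => s sab j.
  have [v [vL xE]] := xW; rewrite xE//; congr (_ + _).
  apply: sub_ae sab ((Linfty_ess_bounded _ _ _).1 vL j) _ _.
    apply: ess_bounded_continuous; exact: (@within_continuous_coord _ _ _ _ _ _ 0 j cF).
  have xd : \forall s \ae mu, s \in `[a, b] -> is_derive s 1 x (f (x s) s + u s).
    apply: filterS xu_d => r dx; rewrite in_itv /= => /andP[ar rb]; apply: dx.
    by rewrite in_itv /= (le_trans a0 ar) (le_trans rb bN).
  apply: filterS2 (W1infty_derivative_ae vL xE xd)
    (filterI (filterI (ae_neq a) (ae_neq b)) uq) => r vE [[ra rb] ur] rab.
  rewrite vE ?ur//.
  by move: rab; rewrite !in_itv /= !lt_neqAle [a == r]eq_sym ra rb => /andP[-> ->].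
(* In the integral defining [q], the integrand f_x^T u is replaced by the continuous -f_x^T q. *)
have Dq : forall s, s \in `[a, b] -> has_derivative_on `[a, b] q s
    (- ((jacobian_x f (x s) s)^T *m (q s)^T)^T).
  have JE s j : (- ((jacobian_x f (x s) s)^T *m (q s)^T)^T) 0 j =
      - \sum_k jacobian_x f (x s) s k j * q s 0 k.
    by rewrite !mxE; congr (- _); apply: eq_bigr => k _; rewrite !mxE.
  have cF : {within `[a, b], continuous
      (fun s => - ((jacobian_x f (x s) s)^T *m (q s)^T)^T)}.
    apply: within_continuous_rV => j.
    rewrite (_ : (fun s => _) = fun s =>
      - \sum_k jacobian_x f (x s) s k j * q s 0 k); last exact/funext.
    move=> s; apply: cvgN; apply: cvg_big => [|k _]; first exact: add_continuous.
    apply: cvgM; last exact: (@within_continuous_coord _ _ _ _ _ _ 0 k cq).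
    exact: (within_continuous_jacobian f_C1).
  apply: (has_derivative_on_primitive (ltW ab) cF) => s sab j.
  rewrite qE; congr (_ + _); apply: sub_ae sab _ _ _ => //.
    apply: ess_bounded_continuous; exact: (@within_continuous_coord _ _ _ _ _ _ 0 j cF).
  apply: filterS uq => r ur rab; rewrite JE mxE -sumrN; apply: eq_bigr => k _.
  by rewrite ur// !mxE; ring.
by move=> s sab; split; [exact: Dx|exact: Dq].
Qed.

Lemma stage_mem (s : R) : s \in `[t 0%N, t N[ ->
  exists i : 'I_N, s \in `[t i, t i.+1[.
Proof.
rewrite in_itv /= => /andP[s0 sN].
have ex : exists i, s < t i by exists N.
(* The first node beyond s is not [t 0], and by minimality its predecessor is at most s. *)
have [[|m] sm mmin] := ex_minnP ex; first by rewrite ltNge s0 in sm.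
have mN : (m < N)%N by apply: mmin.
exists (Ordinal mN); rewrite in_itv /= sm andbT leNgt; apply/negP => /mmin.
by rewrite ltnn.
Qed.

Lemma stage_uniq (s : R) (i k : nat) : (i < N)%N -> (k < N)%N ->
  s \in `[t i, t i.+1[ -> s \in `[t k, t k.+1[ -> i = k.
Proof.
move=> iN kN; rewrite !in_itv /= => /andP[si si1] /andP[sk sk1].
have lt_stage l m : (m < N)%N -> t m <= s -> s < t l.+1 -> (m <= l)%N.
  move=> mN sm sl; rewrite leqNgt; apply/negP => lm.
  have := node_le t_lt (i := l.+1) (j := m); rewrite lm ltnW// => /(_ isT).
  by rewrite leNgt (le_lt_trans sm sl).
by apply/eqP; rewrite eqn_leq (lt_stage k i)// (lt_stage i k).
Qed.

End Optimality.

(** * Gluing the adjoint variables of the stages *)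

Theorem theorem1 (R : realType) (n N : nat)
    (f : 'rV[R]_n -> R -> 'rV[R]_n) (t : nat -> R) (z : nat -> 'rV[R]_n)
    (x u : R -> 'rV[R]_n)
    (t_lt : forall i : nat, (i < N)%N -> t i < t i.+1)
    (z_neq : forall i : nat, (i < N)%N -> z i.+1 <> z i)
    (f_C1 : C1_in_x f (t 0%N) (t N))
    (xu_sol : PL2_solution N f t z x u) :
  exists lambda : R -> 'rV[R]_n,
    (\forall s \ae (@lebesgue_measure R),
       s \in `[t 0%N, t N[ -> u s = - lambda s) /\
    (* q is lambda on the stage, extended to its right node, where lambda
       itself takes the value of the next stage. *)
    forall i : nat, (i < N)%N ->
      exists q : R -> 'rV[R]_n,
        [/\ (forall s : R, s \in `[t i, t i.+1[ -> q s = lambda s),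
            W1infty (t i) (t i.+1) q
          & stage_bvp f (t i) (t i.+1) (z i) (z i.+1) x q].
Proof.
have [q qP] := choice (fun i : 'I_N => PL2_stage_bvp t_lt f_C1 xu_sol (ltn_ord i)).
(* Half-open stages are disjoint, so at an interior node [lambda] takes the value of the stage that
   begins there; outside all stages it is 0 by default. *)
pose lambda s := if [pick i : 'I_N | s \in `[t i, t i.+1[] is Some i
  then q i s else 0.
have lambdaE (i : 'I_N) s : s \in `[t i, t i.+1[ -> lambda s = q i s.
  move=> si; rewrite /lambda; case: pickP => [k sk|/(_ i)]; last by rewrite si.
  by have /val_inj -> := stage_uniq t_lt (ltn_ord k) (ltn_ord i) sk si.
exists lambda; split.
  (* There are finitely many stages, so their exceptional null sets merge into one. *)
  have : \forall s \ae (@lebesgue_measure R), forall i : 'I_N,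
      s \in `[t i, t i.+1] -> u s = - q i s.
    by apply: filter_forall => i; have [] := qP i.
  apply: filterS => s us /stage_mem[i si].
  by rewrite (us i) ?(lambdaE i)//; exact: subset_itv_co_cc.
move=> i iN; have [_ qW qB] := qP (Ordinal iN).
exists (q (Ordinal iN)); split=> // s si.
by rewrite (lambdaE (Ordinal iN)).
Qed.
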